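(* Let $k$ be an algebraically closed field of characteristic zero. For all integers $d,e\geq 2$ with $\sqrt{d}\leq e\leq d^2$, there exists a Cremona transformation of $\mathbb{P}^3$ (over $k$) of bidegree $(d,e)$.
   Context: A Cremona transformation of $\mathbb{P}^3$ is a birational map $F:\mathbb{P}^3\dashrightarrow\mathbb{P}^3$. It has bidegree $(d,e)$ if $F$ and its inverse $F^{-1}$ are defined by homogeneous polynomials, without non-trivial common factors, of degrees $d$ and $e$ respectively. *)

(* Defs.v *)
From mathcomp Require Import all_boot all_order all_algebra all_field.
From mathcomp Require Export mpoly.

Set Implicit Arguments.
Unset Strict Implicit.
Unset Printing Implicit Defensive.

Import Order.TTheory GRing.Theory Num.Theory.
Local Open Scope ring_scope.

(* A rational map P^n --> P^n presented by n+1 forms of the same degree, not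
   all zero. Common factors are allowed, so a rational map has many
   presentations; they are identified by [ratmap_eq]. *)
Record ratmap (k : fieldType) (n : nat) := RatMap {
  forms :> n.+1.-tuple {mpoly k[n.+1]};
  form_degree : nat;
  forms_homog : forall i, tnth forms i \is form_degree.-homog;
  forms_neq0 : exists i, tnth forms i != 0
}.

Section RationalMaps.
Variables (k : fieldType) (n : nat).
Implicit Types (P Q : n.+1.-tuple {mpoly k[n.+1]}) (F G : ratmap k n).

Definition proportional P Q : Prop :=
  forall i j, tnth P i * tnth Q j = tnth P j * tnth Q i.

Definition ratmap_eq F G : Prop := proportional F G.

Definition comp_forms Q P : n.+1.-tuple {mpoly k[n.+1]} :=
  [tuple tnth Q i \mPo P | i < n.+1].

(* G o F is the identity of P^n. The first conjunct says that the composite is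
   defined: the image of F is not contained in the common zero locus of the
   forms of G. *)
Definition is_left_inverse G F : Prop :=
  (exists i, tnth (comp_forms G F) i != 0) /\
  proportional (comp_forms G F) [tuple 'X_i | i < n.+1].

Definition are_inverse F G : Prop := is_left_inverse G F /\ is_left_inverse F G.

Definition cremona F : Prop := exists G, are_inverse F G.

Definition no_common_factor P : Prop :=
  forall h : {mpoly k[n.+1]},
    (forall i, exists q, tnth P i = h * q) -> h \is a GRing.unit.

Definition defined_in_degree F (d : nat) : Prop :=
  exists F' : ratmap k n,
    [/\ ratmap_eq F' F, no_common_factor F' & form_degree F' = d].

Definition has_bidegree F (d e : nat) : Prop :=
  exists G, [/\ are_inverse F G, defined_in_degree F d & defined_in_degree G e].

End RationalMaps.

(* Main.v *)
Require Import Defs.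
From mathcomp Require Import all_boot all_order all_algebra all_field.
From mathcomp Require Import zify ring.
Import Order.TTheory GRing.Theory Num.Theory.
Local Open Scope ring_scope.

(** Both bounds are symmetric under exchanging a map with its inverse: the first
    says that [d <= e ^ 2].  So it suffices to treat [d <= e <= d ^ 2], and there
    an explicit map works.  Put [a = d - 1] and let [1 <= b, j <= d].  In the
    affine chart [w = 1], the map

      [(x, y, z) |-> (x + y^b + z^j, y z^a, z)]

    is triangular over the birational plane map [(y, z) |-> (y z^a, z)], with
    inverse

      [(x, y, z) |-> (x - y^b / z^(b a) - z^j, y / z^a, z)].

    The map has degree [max(b, j, a + 1) = d].  In the inverse, the denominator
    [z^(b a)] multiplies [z^j], so its degree is [b a + j].  Here [z^j] serves to
    tune the degree: as [b] and [j] range over [1..d], [b (d - 1) + j] takes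
    every value from [d] to [d^2] ([bidegree_parameters]).

    The composites of the homogenized maps are a nonzero monomial times the
    coordinates ([triangular_invK], [triangularK]).  That the stated degrees are
    the true ones amounts to the absence of common factors.  In both tuples the
    last form is a product of variables, so a nonunit common factor is
    divisible by one of these variables ([unit_of_mul_vars]); this is excluded
    by a point where that variable vanishes and some other form does not
    ([no_common_factor_of_points]). *)

(** * Divisors of products of variables *)

Section VariablesArePrime.
Context {k : fieldType} {n : nat}.
Implicit Types (p q h : {mpoly k[n]}) (i : 'I_n).

Definition kill_var i : n.-tuple {mpoly k[n]} :=
  [tuple if j == i then 0 else 'X_j | j < n].

Lemma kill_var_congr i p : exists r, p = p \mPo kill_var i + 'X_i * r.
Proof.
elim/mpolyind: p => [|c m p _ _ [r IHr]].
  by exists 0; rewrite comp_mpoly0 mulr0 addr0.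
have [t Dt]: exists t, 'X_[m] = 'X_[m] \mPo kill_var i + 'X_i * t.
  rewrite comp_mpolyX; have [mi0 | mi_gt0] := posnP (m i).
    exists 0; rewrite mulr0 addr0 mpolyXE_id; apply: eq_bigr => j _.
    by rewrite tnth_mktuple; case: eqP => [->|]; rewrite ?mi0.
  exists 'X_[m - U_(i)]; rewrite (bigD1 i) //= tnth_mktuple eqxx.
  rewrite expr0n (gtn_eqF mi_gt0) mul0r add0r -mpolyXD addmC submK //.
  by rewrite lep1mP -lt0n.
exists (c *: t + r).
rewrite comp_mpolyD comp_mpolyZ mulrDr -scalerAr addrACA -scalerDr.
by rewrite -Dt -IHr.
Qed.

(** The ideal of ['X_i] is the kernel of setting ['X_i] to 0, an endomorphism of
    the polynomial ring, which is a domain. *)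
Lemma mpolyX_prime i p q r : p * q = 'X_i * r ->
  (exists s, p = 'X_i * s) \/ (exists s, q = 'X_i * s).
Proof.
move=> /(congr1 (comp_mpoly (kill_var i))); rewrite !rmorphM /= comp_mpolyXU.
rewrite (nth_map i) ?size_enum_ord // nth_ord_enum eqxx mul0r.
move/eqP; rewrite mulf_eq0 => /orP[] /eqP p0; [left | right].
  by have [s] := kill_var_congr i p; rewrite p0 add0r; exists s.
by have [s] := kill_var_congr i q; rewrite p0 add0r; exists s.
Qed.

(** By induction, cancel the variables one at a time: each is prime and does not
    divide [h], so it divides the cofactor [q]. *)
Lemma unit_of_mul_vars h q (s : seq 'I_n) :
    h * q = \prod_(i <- s) 'X_i ->
    {in s, forall i g, h <> 'X_i * g} ->
  h \is a GRing.unit.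
Proof.
elim: s q => [|i s IHs] q; first by rewrite big_nil mulrC => /mpoly_intro_unit.
rewrite big_cons => hq nXh.
have [[g hg] | [g qg]] := mpolyX_prime _ _ _ _ hq.
  by case: (nXh i (mem_head _ _) g).
apply: (IHs g) => [|j sj]; last by apply: nXh; rewrite inE sj orbT.
apply: (@mulfI _ 'X_i); first by rewrite -msupp_eq0 msuppX.
by rewrite -hq qg mulrCA.
Qed.

End VariablesArePrime.

(** * The triangular map and its inverse *)

Lemma forall_ord4 (P : 'I_4 -> Prop) : P 0 -> P 1 -> P 2 -> P 3 -> forall i, P i.
Proof.
move=> P0 P1 P2 P3 [[|[|[|[|//]]]] lti].
- by have -> : Ordinal lti = 0 by apply: val_inj.
- by have -> : Ordinal lti = 1 by apply: val_inj.
- by have -> : Ordinal lti = 2 by apply: val_inj.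
- by have -> : Ordinal lti = 3 by apply: val_inj.
Qed.

Section Forms.
Context {R : comNzRingType}.
Implicit Type v : 4.-tuple R.

(** Identities between monomials reduce to arithmetic on the four exponents. *)
Definition mon v (p q r s : nat) : R :=
  tnth v 0 ^+ p * tnth v 1 ^+ q * tnth v 2 ^+ r * tnth v 3 ^+ s.

Lemma monM v p q r s p' q' r' s' :
  mon v p q r s * mon v p' q' r' s' =
  mon v (p + p') (q + q') (r + r') (s + s').
Proof. by rewrite /mon !exprD; ring. Qed.

Lemma monX v p q r s n :
  mon v p q r s ^+ n = mon v (p * n) (q * n) (r * n) (s * n).
Proof. by rewrite /mon !exprMn -!exprM. Qed.

(** The map [(x + y^b + z^j, y z^a, z)], homogenized in degree [a + 1].  It is
    defined over any commutative ring, so that substituting forms and evaluating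
    at points are both instances of its naturality ([map_triangular]). *)
Definition triangular a b j v : 4.-tuple R :=
  [tuple mon v 1 0 0 a + mon v 0 b 0 (a.+1 - b) + mon v 0 0 j (a.+1 - j);
         mon v 0 1 a 0; mon v 0 0 1 a; mon v 0 0 0 a.+1].

(** The affine inverse, cleared of denominators: its coordinates are multiplied by
    [z^(b a) w^j], the last form, which gives degree [b a + j]. *)
Definition triangular_inv a b j v : 4.-tuple R :=
  [tuple mon v 1 0 (b * a) j.-1 - mon v 0 b 0 (b * a + j - b)
           - mon v 0 0 (b * a + j) 0;
         mon v 0 1 (b.-1 * a) (a.-1 + j);
         mon v 0 0 (b * a).+1 j.-1; mon v 0 0 (b * a) j].

Lemma mon_vars v i : tnth v i = mon v (i == 0) (i == 1) (i == 2) (i == 3).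
Proof. by elim/forall_ord4: i; rewrite /mon /=; ring. Qed.

(** The first coordinate of a composite has this shape: what one map adds to the
    first coordinate, the other removes. *)
Lemma add_then_cancel (m1 m2 m3 n1 n2 n3 : R) : m1 = n1 -> m2 = n2 -> m3 = n3 ->
  m1 + m2 + m3 - n2 - n3 = n1.
Proof. by move=> -> -> ->; ring. Qed.

Lemma sub_then_cancel (m1 m2 m3 n1 n2 n3 : R) : m1 = n1 -> m2 = n2 -> m3 = n3 ->
  m1 - m2 - m3 + n2 + n3 = n1.
Proof. by move=> -> -> ->; ring. Qed.

Lemma mon_split v q r s : mon v 1 q r s = tnth v 0 * mon v 0 q r s.
Proof. by rewrite /mon; ring. Qed.

Lemma mon_triangular a b j v q r s :
  mon (triangular a b j v) 0 q r s = mon v 0 q (q * a + r) (r * a + s * a.+1).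
Proof.
rewrite {1}/mon !(tnth_nth 0) /= expr0 mul1r !monX !monM.
by congr mon; lia.
Qed.

Lemma mon_triangular_inv a b j v q r s :
  mon (triangular_inv a b j v) 0 q r s =
  mon v 0 q (q * (b.-1 * a) + r * (b * a).+1 + s * (b * a))
    (q * (a.-1 + j) + r * j.-1 + s * j).
Proof.
rewrite {1}/mon !(tnth_nth 0) /= expr0 mul1r !monX !monM.
by congr mon; lia.
Qed.

Section Inverse.
Variables (a b j : nat) (v : 4.-tuple R).
Hypotheses (a_gt0 : (0 < a)%N) (b_gt0 : (0 < b)%N) (j_gt0 : (0 < j)%N).
Hypotheses (leba : (b <= a.+1)%N) (leja : (j <= a.+1)%N).

Lemma triangular_invK i :
  tnth (triangular_inv a b j (triangular a b j v)) i =
  mon v 0 0 (b * a) (b * a * a + a.+1 * j).-1 * tnth v i.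
Proof.
rewrite (mon_vars v i).
elim/forall_ord4: i; rewrite (tnth_nth 0) /=.
- rewrite mon_split !mon_triangular (tnth_nth 0) /= !mulrDl !monM.
  by apply: add_then_cancel; congr mon; nia.
- by rewrite !mon_triangular !monM; congr mon; nia.
- by rewrite !mon_triangular !monM; congr mon; nia.
- by rewrite !mon_triangular !monM; congr mon; nia.
Qed.

Lemma triangularK i :
  tnth (triangular a b j (triangular_inv a b j v)) i =
  mon v 0 0 (b * a * a.+1) (a.+1 * j).-1 * tnth v i.
Proof.
rewrite (mon_vars v i).
elim/forall_ord4: i; rewrite (tnth_nth 0) /=.
- rewrite mon_split !mon_triangular_inv (tnth_nth 0) /= !mulrDl !mulNr !monM.
  by apply: sub_then_cancel; congr mon; nia.
- by rewrite !mon_triangular_inv !monM; congr mon; nia.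
- by rewrite !mon_triangular_inv !monM; congr mon; nia.
- by rewrite !mon_triangular_inv !monM; congr mon; nia.
Qed.
End Inverse.
End Forms.

Lemma map_mon {R S : comNzRingType} (f : {rmorphism R -> S}) v p q r s :
  f (mon v p q r s) = mon (map_tuple f v) p q r s.
Proof. by rewrite /mon !rmorphM !rmorphXn !tnth_map. Qed.

Lemma map_triangular {R S : comNzRingType} (f : {rmorphism R -> S}) a b j v i :
  f (tnth (triangular a b j v) i) = tnth (triangular a b j (map_tuple f v)) i.
Proof.
by elim/forall_ord4: i; rewrite !(tnth_nth 0) /= ?rmorphD /= !map_mon.
Qed.

Lemma map_triangular_inv {R S : comNzRingType} (f : {rmorphism R -> S}) a b j v i :
  f (tnth (triangular_inv a b j v) i) = tnth (triangular_inv a b j (map_tuple f v)) i.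
Proof.
by elim/forall_ord4: i; rewrite !(tnth_nth 0) /= ?rmorphB /= !map_mon.
Qed.

(** * Criteria for inverses and for degrees *)

Section Criteria.
Context {k : fieldType} {n : nat}.
Implicit Types (P : n.+1.-tuple {mpoly k[n.+1]}) (F G : ratmap k n).

Lemma left_inverse_of_scale G F m : m != 0 ->
  (forall i, tnth G i \mPo F = m * 'X_i) -> is_left_inverse G F.
Proof.
move=> m_neq0 GF; split.
  by exists ord0; rewrite tnth_mktuple GF mulf_neq0 // -msupp_eq0 msuppX.
by move=> i l; rewrite !tnth_mktuple !GF; ring.
Qed.

(** If a variable [X_i] of the product divided a common factor, all forms would
    vanish on the hyperplane [X_i = 0]. *)
Lemma no_common_factor_of_points P l (s : seq 'I_n.+1) :
    tnth P l = \prod_(i <- s) 'X_i ->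
    {in s, forall i, exists m (v : 'I_n.+1 -> k),
       v i = 0 /\ (tnth P m).@[v] != 0} ->
  no_common_factor P.
Proof.
move=> Pl pts h hP; have [q Dq] := hP l.
apply: (@unit_of_mul_vars _ _ h q s); first by rewrite -Dq.
move=> i /pts[m [v [vi0]]] + g hg; have [t ->] := hP m.
by rewrite hg !mevalM mevalXU vi0 !mul0r eqxx.
Qed.

Lemma defined_in_form_degree F :
  no_common_factor F -> defined_in_degree F (form_degree F).
Proof. by move=> ncF; exists F; split=> // i j; rewrite mulrC. Qed.

End Criteria.

(** * The maps of projective space *)

Section Space.
Context {k : fieldType}.

Local Notation vars := [tuple 'X_i : {mpoly k[4]} | i < 4].

Lemma mon_vars_neq0 p q r s : mon vars p q r s != 0.
Proof.
by rewrite /mon !tnth_mktuple !mulf_neq0 // expf_neq0 // -msupp_eq0 msuppX.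
Qed.

Lemma mon_vars_homog p q r s d :
  (p + q + r + s)%N = d -> mon vars p q r s \is d.-homog.
Proof.
move=> <-; have homX (i : 'I_4) t : tnth vars i ^+ t \is t.-homog.
  by rewrite -[t in t.-homog]mul1n dhomogMn // tnth_mktuple dhomogX /= mdeg1.
by rewrite !dhomogM.
Qed.

Lemma map_vars_comp (P : 4.-tuple {mpoly k[4]}) :
  map_tuple (comp_mpoly P) vars = P.
Proof.
by apply: eq_from_tnth => i; rewrite tnth_map tnth_mktuple comp_mpolyXU -tnth_nth.
Qed.

Lemma map_vars_eval (v : 4.-tuple k) : map_tuple (meval (tnth v)) vars = v.
Proof.
by apply: eq_from_tnth => i; rewrite tnth_map tnth_mktuple mevalXU.
Qed.

Variables (a b j : nat).
Hypotheses (a_gt0 : (0 < a)%N) (b_gt0 : (0 < b)%N) (j_gt0 : (0 < j)%N).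
Hypotheses (leba : (b <= a.+1)%N) (leja : (j <= a.+1)%N).

Lemma triangular_homog i : tnth (triangular a b j vars) i \is (a.+1).-homog.
Proof.
by elim/forall_ord4: i; rewrite (tnth_nth 0) /= ?rpredD // mon_vars_homog; lia.
Qed.

Lemma triangular_inv_homog i :
  tnth (triangular_inv a b j vars) i \is (b * a + j).-homog.
Proof.
by elim/forall_ord4: i; rewrite (tnth_nth 0) /= ?rpredB // mon_vars_homog; nia.
Qed.

Fact triangular_neq0 : exists i, tnth (triangular a b j vars) i != 0.
Proof. by exists 3; rewrite (tnth_nth 0) mon_vars_neq0. Qed.

Fact triangular_inv_neq0 : exists i, tnth (triangular_inv a b j vars) i != 0.
Proof. by exists 3; rewrite (tnth_nth 0) mon_vars_neq0. Qed.

Definition triangular_map : ratmap k 3 :=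
  RatMap triangular_homog triangular_neq0.
Definition triangular_inv_map : ratmap k 3 :=
  RatMap triangular_inv_homog triangular_inv_neq0.

Lemma triangular_inverse : are_inverse triangular_map triangular_inv_map.
Proof.
split; apply: left_inverse_of_scale (mon_vars_neq0 0 0 _ _) _ => i.
  by rewrite map_triangular_inv map_vars_comp triangular_invK // tnth_mktuple.
by rewrite map_triangular map_vars_comp triangularK // tnth_mktuple.
Qed.

Lemma triangular_no_common_factor : no_common_factor (triangular a b j vars).
Proof.
apply: (@no_common_factor_of_points _ _ _ 3 (nseq a.+1 3)) => [|i].
  by rewrite big_nseq iter_mulr_1 (tnth_nth 0) /= /mon !tnth_mktuple !mul1r.
rewrite mem_nseq => /eqP->.
(* On [w = 0], the form [y z^a] is nonzero at [(0 : 1 : 1 : 0)]. *)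
exists 1, (tnth [tuple 0; 1; 1; 0]); split; first by rewrite (tnth_nth 0).
rewrite map_triangular map_vars_eval !(tnth_nth 0) /= /mon !(tnth_nth 0) /=.
by rewrite !expr1n !expr0 !mulr1 oner_neq0.
Qed.

Lemma triangular_inv_no_common_factor :
  no_common_factor (triangular_inv a b j vars).
Proof.
apply: (@no_common_factor_of_points _ _ _ 3 (nseq (b * a) 2 ++ nseq j 3))
    => [|i].
  rewrite big_cat !big_nseq !iter_mulr_1 (tnth_nth 0) /= /mon !tnth_mktuple.
  by rewrite !mul1r.
rewrite mem_cat !mem_nseq => /orP[] /andP[_ /eqP->].
  (* On [z = 0], only the term [- y^b w^(b a + j - b)] of the first form survives
     when also [x = 0]. *)
  exists 0, (tnth [tuple 0; 1; 0; 1]); split; first by rewrite (tnth_nth 0).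
  rewrite map_triangular_inv map_vars_eval !(tnth_nth 0) /= /mon !(tnth_nth 0) /=.
  rewrite (expr0n _ (b * a + j)) addn_eq0 [j == 0%N]gtn_eqF // andbF.
  rewrite expr1 !expr1n !expr0 !(mul0r, mulr0, mul1r) sub0r subr0.
  by rewrite oppr_eq0 oner_neq0.
(* At [(0 : 0 : 1 : 0)], the first form reduces to its term [- z^(b a + j)]. *)
exists 0, (tnth [tuple 0; 0; 1; 0]); split; first by rewrite (tnth_nth 0).
rewrite map_triangular_inv map_vars_eval !(tnth_nth 0) /= /mon !(tnth_nth 0) /=.
rewrite (expr0n _ b) gtn_eqF //.
rewrite expr1 !expr1n !expr0 !(mul0r, mulr0, mul1r) subr0 sub0r.
by rewrite oppr_eq0 oner_neq0.
Qed.

End Space.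

(** Divide [e - 1] by [a]; the quotient is too large only for [e = (a + 1) ^ 2],
    where [b = j = a + 1]. *)
Lemma bidegree_parameters a e : (0 < a)%N -> (a.+1 <= e <= a.+1 ^ 2)%N ->
  exists b j, [/\ (0 < b <= a.+1)%N, (0 < j <= a.+1)%N & e = (b * a + j)%N].
Proof.
move=> a_gt0 /andP[lee ele]; case: (ltnP e (a.+1 ^ 2)) => [elt | gee].
  exists (e.-1 %/ a)%N, (e.-1 %% a).+1%N.
  have := divn_eq e.-1 a; have := ltn_pmod e.-1 a_gt0.
  by move: (e.-1 %/ a)%N (e.-1 %% a)%N => q r; split; nia.
by exists a.+1, a.+1; split; nia.
Qed.

Lemma cremona_bidegree (k : fieldType) d e : (2 <= d)%N -> (d <= e <= d ^ 2)%N ->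
  exists F G : ratmap k 3,
    [/\ are_inverse F G, defined_in_degree F d & defined_in_degree G e].
Proof.
case: d => [//|a]; rewrite ltnS => a_gt0.
case/(bidegree_parameters _ _ a_gt0)=> b [j [/andP[b0 bd] /andP[j0 jd] ->]].
exists (triangular_map a b j a_gt0 b0 j0 bd jd),
  (triangular_inv_map a b j a_gt0 b0 j0 bd jd).
split; first exact: triangular_inverse.
  apply: (defined_in_form_degree (triangular_map _ _ _ _ _ _ _ _)).
  exact: triangular_no_common_factor.
apply: (defined_in_form_degree (triangular_inv_map _ _ _ _ _ _ _ _)).
exact: triangular_inv_no_common_factor.
Qed.

Theorem corollary4 (k : closedFieldType) (hk : [pchar k] =i pred0)
    (d e : nat) (hd : (2 <= d)%N) (he : (2 <= e)%N)
    (hde : sqrtC (d%:R : algC) <= e%:R) (hed : (e <= d ^ 2)%N) :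
  exists F : ratmap k 3, cremona F /\ has_bidegree F d e.
Proof.
(* Squaring the first bound puts it in the form of the second. *)
have led : (d <= e ^ 2)%N.
  rewrite -(ler_nat algC) natrX -[d%:R]sqrtCK lerXn2r // ?nnegrE ?ler0n //.
  by rewrite sqrtC_ge0 ler0n.
have [de | ed] := leqP d e.
  have [|F [G [FG Fd Ge]]] := cremona_bidegree k d e hd; first by rewrite de.
  by exists F; split; exists G.
have [|F [G [[FG GF] Fe Gd]]] := cremona_bidegree k e d he.
  by rewrite ltnW.
by exists G; split; exists F.
Qed.
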